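(* Let $(W,S)$ be a spherical crystallographic Coxeter system with root system $\Phi$ and set of reflections $T$. Then the following holds. (a) A subset $X$ of $T$ generates $W$ if and only if the related set of roots $R = R(X)$ generates the root lattice $L(\Phi)$ (that is, $L(R)=L(\Phi)$) and $R^\vee$ generates the coroot lattice $L(\Phi^\vee)$ (that is, $L(R^\vee)=L(\Phi^\vee)$). (b) A subset $X$ of $T$ that generates $W$ is a minimal generating subset if and only if $R=R(X)$ and $R^\vee$ are bases of the lattices $L(\Phi)$ and $L(\Phi^\vee)$, respectively.
   Context: A spherical Coxeter system is a Coxeter system $(W,S)$ with $W$ finite. Let $V$ be a finite-dimensional real Euclidean vector space with inner product $(\cdot\mid\cdot)$; for $0\ne\alpha\in V$ let $s_\alpha(v)=v-\frac{2(\alpha\mid v)}{(\alpha\mid\alpha)}\alpha$. The group $W$ is identified with its image under a faithful geometric representation $W\to\mathrm{GL}(V)$ in which each $s\in S$ acts as a reflection $s_{\alpha_s}$, where the vectors $\alpha_s$ ($s\in S$) span $V$. The root system of $(W,S)$ is $\Phi=\{w(\alpha_s)\mid w\in W,\ s\in S\}$; it is a finite set of nonzero vectors spanning $V$ with $s_\alpha(\Phi)=\Phi$ and $\Phi\cap\mathbb{R}\alpha=\{\pm\alpha\}$ for all $\alpha\in\Phi$, and $W=\langle s_\alpha\mid\alpha\in\Phi\rangle$. Crystallographic means $\frac{2(\alpha\mid\beta)}{(\alpha\mid\alpha)}\in\mathbb{Z}$ for all $\alpha,\beta\in\Phi$. The set of reflections is $T=\{wsw^{-1}\mid w\in W, s\in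 S\}=\{s_\alpha\mid\alpha\in\Phi\}$. The map $\Phi\to T$, $\alpha\mapsto s_\alpha$, is $2$-to-$1$ (with $s_\alpha=s_{-\alpha}$). For $X\subseteq T$, the related set of roots $R(X)\subseteq\Phi$ consists of one root $\alpha$ with $s_\alpha=t$ chosen for each $t\in X$ (the choice of sign is irrelevant). ''Minimal generating subset'' means a generating subset of $W$ contained in $T$ that is minimal with respect to inclusion. For a set of roots $R$, $\alpha^\vee=\frac{2\alpha}{(\alpha\mid\alpha)}$, $R^\vee=\{\alpha^\vee\mid\alpha\in R\}$, $L(R)=\mathrm{span}_{\mathbb{Z}}(R)$, $L(R^\vee)=\mathrm{span}_{\mathbb{Z}}(R^\vee)$; $L(\Phi)$ is the root lattice and $L(\Phi^\vee)$ the coroot lattice. *)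

(* Defs.v *)
From HB Require Import structures.
From mathcomp Require Import all_boot all_order all_fingroup all_algebra.
From mathcomp Require Import reals.

Set Implicit Arguments.
Unset Strict Implicit.
Unset Printing Implicit Defensive.

Import Order.TTheory GRing.Theory Num.Theory GroupScope.

Local Open Scope ring_scope.

(* W = < S | (s t)^m(s,t) = 1 >, where m(s,t) is the order of s t: S consists
   of involutions, generates W, and W has the universal property of the
   presentation with respect to all (possibly infinite) groups H. *)
Record Coxeter_system (gT : finGroupType) (W : {group gT}) (S : {set gT}) :
    Prop := {
  Coxeter_gen : <<S>>%g = W;
  Coxeter_involution : {in S, forall s, #[s]%g = 2};
  Coxeter_presentation : forall (H : groupType) (f : gT -> H),
    {in S &, forall s t, ((f s * f t) ^+ #[s * t])%g = 1%g} ->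
    exists2 g : gT -> H,
      {in W &, forall x y, g (x * y)%g = (g x * g y)%g} &
      {in S, forall s, g s = f s} }.

Definition reflections (gT : finGroupType) (W S : {set gT}) : {set gT} :=
  [set (w * s * w^-1)%g | w in W, s in S].

Definition minimal_generating (gT : finGroupType) (W S X : {set gT}) : bool :=
  minset (fun Y : {set gT} => (Y \subset reflections W S) && (<<Y>>%g == W)) X.

Section Roots.
Variables (R : realType) (V : vectType R).
(* The library's positive definite symmetric bilinear forms on V. *)
Variable ip : {dot V for (@idfun R)}.

Definition root_reflection (a v : V) : V := v - (2 * ip a v / ip a a) *: a.

Definition coroot (a : V) : V := (2 / ip a a) *: a.

Section Representation.
Variables (gT : finGroupType) (W S : {set gT}).
Variables (rho : gT -> 'End(V)) (alpha : gT -> V).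

Record geometric_representation : Prop := {
  geom1 : rho 1%g = \1%VF;
  geomM : {in W &, forall x y, rho (x * y)%g = (rho x \o rho y)%VF};
  geom_faithful : {in W &, injective rho};
  geom_neq0 : {in S, forall s, alpha s != 0};
  geom_reflect : {in S, forall s v, rho s v = root_reflection (alpha s) v};
  geom_span : (<<[seq alpha s | s <- enum S]>> = fullv)%VS }.

Definition Coxeter_roots : seq V :=
  [seq rho w (alpha s) | w <- enum W, s <- enum S].

(* r picks, for every reflection t in X, a root r t with t acting as s_(r t). *)
Definition root_choice (X : {set gT}) (r : gT -> V) : Prop :=
  {in X, forall t,
    r t \in Coxeter_roots /\ forall v, rho t v = root_reflection (r t) v}.

End Representation.

(* Phi meets every line R a, a in Phi, in {a, -a}; this only fixes the relative
   lengths of the alpha_s for conjugate s in S. *)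
Definition reduced_roots (Phi : seq V) : Prop :=
  {in Phi, forall a (c : R), c *: a \in Phi -> c = 1 \/ c = -1}.

Definition crystallographic (Phi : seq V) : Prop :=
  {in Phi &, forall a b, 2 * ip a b / ip a a \is a Num.int}.

Definition zspan (s : seq V) (v : V) : Prop := inIntSpan (in_tuple s) v.

Definition same_lattice (s t : seq V) : Prop :=
  forall v, zspan s v <-> zspan t v.

Definition zfree (s : seq V) : Prop :=
  forall a : int ^ size s,
    \sum_(i < size s) s`_i *~ a i = 0 -> forall i, a i = 0.

(* b is a basis of the lattice generated by s *)
Definition lattice_basis (s b : seq V) : Prop := zfree b /\ same_lattice b s.

End Roots.

(* Main.v *)
Require Import Defs.
From HB Require Import structures.
From mathcomp Require Import all_boot all_order all_fingroup all_algebra.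
From mathcomp Require Import boolp reals ring lra zify.

(** Write R for the roots of X and L(R) for their integral span.

    If X generates W, every s in S is conjugate in W to an element of X: by the
    presentation of W, sending s to 1 if it has such a conjugate and to a
    fixed involution otherwise extends to a homomorphism, because s and t are
    conjugate when s t has odd order; it is trivial on X, hence on W
    ([generating_conjugates]).  So every root is, up to sign, the image of a
    root of R under W = <X>; by integrality the reflections in R preserve L(R)
    and L(R^v), so these contain every root and every coroot
    ([generating_lattice]).

    Conversely, call a root short if it is no longer than any root not
    orthogonal to it.  For a short b and another root a with (b | a) > 0 one
    has s_a b = b - a.  Hence a short b in L(R), written as a sum of elements
    of R and -R with as few terms as possible, loses a term by a reflection of
    X, and descending one sees that s_b lies in <X> ([short_root_descent]).  A
    root which is not short has a short coroot ([short_or_long]), and the same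
    argument applied to L(R^v) settles it.  So <X> contains all reflections
    ([lattice_generating]).

    In (b), if R is free no root of R lies in the span of the others, so X is
    minimal by (a).  The substance is the converse: a dependent R contains a
    root that can be omitted without changing L(R) or L(R^v)
    ([redundant_root]).  Take a relation sum_i c_i r_i = 0, unique up to
    scalars, with signs such that all c_i are nonnegative, and let g be the
    gcd of the c_i.  Choose integers h_i with sum_i c_i h_i = g.  They are the
    values at a point x of affine functions (x | r_i) + D with one constant
    D > 0.  Reflecting x in the walls of the chamber where these functions are
    nonnegative keeps the values integral and moves x into the chamber
    ([integral_affine_chamber]).  There the h_i are nonnegative and still
    satisfy sum_i c_i h_i = g, which forces some c_k = g: then r_k is an
    integral combination of the others.  The coroots satisfy the relation with
    coefficients c_i |r_i|^2.  On its support the squared lengths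
    take at most two values, with ratio a prime, and comparing the two gcds
    shows that one index k serves both relations ([circuit_common_divisor]). *)

Set Implicit Arguments.
Unset Strict Implicit.
Unset Printing Implicit Defensive.

Import Order.TTheory GRing.Theory Num.Theory.

Local Open Scope ring_scope.

(** * Integral spans *)

Section IntegralSpan.
Variables (R : realType) (V : vectType R).
Implicit Types (s t : seq V) (b u v : V).

Lemma zspan_mem s v : v \in s -> zspan s v.
Proof.
move=> sv; have ltvs : (index v s < size s)%N by rewrite index_mem.
exists [ffun i => (i == Ordinal ltvs)%:Z].
rewrite (bigD1 (Ordinal ltvs)) //= ffunE eqxx big1 ?addr0 => [|i /negPf ne].
  by rewrite mulr1z nth_index.
by rewrite ffunE ne.
Qed.

Lemma zspanMz s v (m : int) : zspan s v -> zspan s (v *~ m).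
Proof.
case=> a ->; exists [ffun i => a i * m].
by rewrite mulrz_suml; apply: eq_bigr => i _; rewrite ffunE mulrzA.
Qed.

Lemma zspanD s u v : zspan s u -> zspan s v -> zspan s (u + v).
Proof.
case=> a -> [b ->]; exists [ffun i => a i + b i].
by rewrite -big_split; apply: eq_bigr => i _; rewrite ffunE mulrzDr.
Qed.

Lemma zspanN s v : zspan s v -> zspan s (- v).
Proof. by rewrite -mulrN1z; apply: zspanMz. Qed.

Lemma zspan_sum s (I : Type) (r : seq I) (P : pred I) (F : I -> V) :
  (forall i, P i -> zspan s (F i)) -> zspan s (\sum_(i <- r | P i) F i).
Proof.
move=> sF; elim/big_rec: _ => [|i x Pi sx]; last exact: zspanD (sF i Pi) sx.
exists [ffun=> 0]; rewrite big1 // => i _; by rewrite ffunE mulr0z.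
Qed.

Lemma zspan_trans s t v :
  {in s, forall u, zspan t u} -> zspan s v -> zspan t v.
Proof.
move=> st [a ->]; apply: zspan_sum => i _; apply/zspanMz/st.
by rewrite mem_nth.
Qed.

Lemma zspan_sub s t v : {subset s <= t} -> zspan s v -> zspan t v.
Proof. by move=> st; apply: zspan_trans => u /st/zspan_mem. Qed.

Lemma same_lattice_sub s t : {in s, forall u, zspan t u} ->
  {in t, forall u, zspan s u} -> same_lattice s t.
Proof. by move=> st ts v; split; apply: zspan_trans. Qed.

Lemma zfree_head a s : zfree s -> ~ zfree (a :: s) ->
  exists c : 'I_(size s).+1 -> int, c ord0 != 0
    /\ \sum_(i < (size s).+1) (a :: s)`_i *~ c i = 0.
Proof.
move=> frs /existsNP[c] /not_implyP[rel_c nz_c]; exists c; split=> //.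
apply/eqP=> c0; apply: nz_c.
have /frs z : \sum_(i < size s) s`_i *~ [ffun i => c (lift ord0 i)] i = 0.
  rewrite -[RHS]rel_c big_ord_recl c0 mulr0z add0r.
  by apply: eq_bigr => i _; rewrite ffunE.
move=> i; case: (unliftP ord0 i) => [j ->|->]; last exact: c0.
by have:= z j; rewrite ffunE.
Qed.

(** Redundancy of b in s would give a relation on s whose coefficient at the
    first occurrence of b is 1. *)
Lemma zfree_irredundant s t b :
  zfree s -> b \in s -> {in t, forall x, x \in s /\ x != b} -> ~ zspan t b.
Proof.
move=> frs bs ts [a Eb].
have ltbs : (index b s < size s)%N by rewrite index_mem.
pose k := Ordinal ltbs; have sk : s`_k = b by apply: nth_index.
have /fin_all_exists[i iP] (j : 'I_(size t)) :
    exists i : 'I_(size s), s`_i = t`_j /\ i != k.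
  have [tjs tjb] := ts _ (mem_nth 0 (ltn_ord j)).
  have lts : leq (index t`_j s).+1 (size s) by rewrite index_mem.
  exists (Ordinal lts); rewrite [LHS]nth_index //; split=> //.
  apply: contraNneq tjb => /(congr1 (fun i : 'I__ => s`_i)).
  by rewrite sk /= nth_index // => ->.
pose c := [ffun l => (l == k)%:Z - \sum_(j | i j == l) a j].
have : \sum_(l < size s) s`_l *~ c l = 0.
  under eq_bigr do rewrite ffunE mulrzBr.
  rewrite sumrB (bigD1 k) //= eqxx mulr1z sk big1 ?addr0; last first.
    by move=> l /negPf ->; rewrite mulr0z.
  under [X in _ - X]eq_bigr do rewrite mulrz_sumr.
  rewrite (exchange_big_dep xpredT) //= {1}Eb.
  apply/eqP; rewrite subr_eq0; apply/eqP.
  apply: eq_bigr => j _; rewrite (big_pred1 (i j)) ?(iP j).1 //.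
move/frs/(_ k)/eqP; rewrite ffunE eqxx big_pred0 ?subr0 // => j.
exact: negPf (iP j).2.
Qed.

End IntegralSpan.

(** * Reflections and coroots *)

Section Reflection.
Variables (R : realType) (V : vectType R) (ip : {dot V for (@idfun R)}).
Implicit Types (a b u v x : V).

Lemma ipC u v : ip u v = ip v u.
Proof. by rewrite (hermC ip) expr0 mul1r. Qed.

Lemma ip_gt0 v : v != 0 -> 0 < ip v v.
Proof. exact: neq0_dnorm_gt0. Qed.

Lemma ip_neq0 v : v != 0 -> ip v v != 0.
Proof. by move/ip_gt0/lt0r_neq0. Qed.

Lemma ipDl u v x : ip (u + v) x = ip u x + ip v x.
Proof. exact: linearDl. Qed.

Lemma ipNl v x : ip (- v) x = - ip v x.
Proof. exact: linearNl. Qed.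

Lemma ipZl (k : R) v x : ip (k *: v) x = k * ip v x.
Proof. exact: linearZl_LR. Qed.

Lemma ipDr u v x : ip x (u + v) = ip x u + ip x v.
Proof. by rewrite ipC ipDl !(ipC x). Qed.

Lemma ipNr v x : ip x (- v) = - ip x v.
Proof. by rewrite ipC ipNl ipC. Qed.

Lemma ipZr (k : R) v x : ip x (k *: v) = k * ip x v.
Proof. by rewrite ipC ipZl ipC. Qed.

Lemma ip0l x : ip 0 x = 0. Proof. exact: linear0l. Qed.

Lemma ip_suml (I : Type) (r : seq I) (P : pred I) (F : I -> V) x :
  ip (\sum_(i <- r | P i) F i) x = \sum_(i <- r | P i) ip (F i) x.
Proof. exact: linear_sumlz. Qed.

Definition ipE := (ipDl, ipNl, ipZl, ipDr, ipNr, ipZr).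

Lemma scale_intr v (m : int) : v *~ m = m%:~R *: v.
Proof. by rewrite scaler_int. Qed.

Lemma ip_eq0 v : ip v v = 0 -> v = 0.
Proof. by move=> v0; apply/eqP; apply: contraT => /ip_neq0; rewrite v0 eqxx. Qed.

(** The pairing of b with the coroot of a, in this order: it is the
    coefficient by which s_a moves b. *)
Definition cartan a b : R := 2 * ip a b / ip a a.

Lemma reflE a v : root_reflection ip a v = v - cartan a v *: a.
Proof. by []. Qed.

Lemma refl_ip a u v :
  ip (root_reflection ip a u) (root_reflection ip a v) = ip u v.
Proof.
have [->|/ip_neq0 a0] := eqVneq a 0.
  by rewrite /root_reflection !scaler0 !subr0.
rewrite /root_reflection !ipE (ipC u a); by field.
Qed.

Lemma refl_self a : a != 0 -> root_reflection ip a a = - a.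
Proof.
move/ip_neq0 => a0; rewrite /root_reflection mulfK // -{1}[a]scale1r -scalerBl.
by rewrite -scaleN1r; congr (_ *: _); lra.
Qed.

Lemma reflZr a (k : R) v :
  root_reflection ip a (k *: v) = k *: root_reflection ip a v.
Proof.
rewrite /root_reflection ipZr scalerBr !scalerA; congr (_ - _ *: _).
by rewrite !mulrA [k * 2]mulrC.
Qed.

Lemma reflK a : involutive (root_reflection ip a).
Proof.
move=> v; have [->|a0] := eqVneq a 0.
  by rewrite /root_reflection !scaler0 !subr0.
have := ip_neq0 a0 => nz; rewrite /root_reflection !ipE -addrA -opprD -scalerDl.
rewrite [X in X *: _](_ : _ = 0) ?scale0r ?subr0 //; by field.
Qed.

Lemma reflZl (k : R) a v :
  k != 0 -> root_reflection ip (k *: a) v = root_reflection ip a v.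
Proof.
move=> k0; have [->|/ip_neq0 a0] := eqVneq a 0; first by rewrite scaler0.
rewrite /root_reflection !ipE scalerA; congr (_ - _ *: _).
by field; rewrite a0 k0.
Qed.

Lemma reflNl a v : root_reflection ip (- a) v = root_reflection ip a v.
Proof. by rewrite -scaleN1r reflZl // oppr_eq0 oner_eq0. Qed.

Lemma refl_isometry (f : {linear V -> V}) a v :
  (forall x y, ip (f x) (f y) = ip x y) ->
  f (root_reflection ip a v) = root_reflection ip (f a) (f v).
Proof. by move=> fi; rewrite /root_reflection linearB linearZ /= !fi. Qed.

(** Compare the two reflections at a: the first gives - a, and the second
    moves a along b. *)
Lemma refl_eq_colinear a b : a != 0 -> b != 0 ->
  root_reflection ip a =1 root_reflection ip b -> exists k : R, a = k *: b.
Proof.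
move=> a0 b0 /(_ a); rewrite refl_self // reflE => E.
exists (cartan b a / 2); rewrite mulrC -scalerA.
have -> : cartan b a *: b = a + a by apply/eqP; rewrite -subr_eq -opprB -E opprK.
by rewrite -mulr2n -scaler_nat scalerA mulVf ?scale1r // pnatr_eq0.
Qed.

Lemma coroot_neq0 a : a != 0 -> coroot ip a != 0.
Proof.
move=> a0; rewrite /coroot scaler_eq0 (negPf a0) orbF.
by rewrite mulf_neq0 ?invr_eq0 ?ip_neq0 // pnatr_eq0.
Qed.

Lemma refl_coroot a v : a != 0 ->
  root_reflection ip (coroot ip a) v = root_reflection ip a v.
Proof.
by move=> a0; rewrite reflZl // mulf_neq0 ?invr_eq0 ?ip_neq0 // pnatr_eq0.
Qed.

Lemma coroot_isometry a (f : V -> V) : (forall k v, f (k *: v) = k *: f v) ->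
  ip (f a) (f a) = ip a a -> f (coroot ip a) = coroot ip (f a).
Proof. by move=> fZ fi; rewrite /coroot fZ fi. Qed.

Lemma corootN a : coroot ip (- a) = - coroot ip a.
Proof. by rewrite /coroot !ipE opprK scalerN. Qed.

Lemma coroot_ip a b : a != 0 -> b != 0 ->
  ip (coroot ip a) (coroot ip b) = 4 * ip a b / (ip a a * ip b b).
Proof.
by move=> /ip_neq0 a0 /ip_neq0 b0; rewrite /coroot !ipE; field; rewrite a0 b0.
Qed.

Lemma corootK a : a != 0 -> coroot ip (coroot ip a) = a.
Proof.
move=> a0; rewrite {1}/coroot coroot_ip // /coroot scalerA.
have := ip_neq0 a0 => nz; rewrite -[RHS]scale1r; congr (_ *: _); by field.
Qed.

(** Passing to coroots transposes the Cartan matrix; this is what lets every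
    statement about roots be reused for coroots. *)
Lemma cartan_coroot a b : a != 0 -> b != 0 ->
  cartan (coroot ip a) (coroot ip b) = cartan b a.
Proof.
move=> a0 b0; rewrite /cartan !coroot_ip // (ipC b a).
by have /ip_neq0 := a0; have /ip_neq0 := b0 => *; field; apply/andP.
Qed.

End Reflection.

(** * Root systems *)

Section RootSystem.
Variables (R : realType) (V : vectType R) (ip : {dot V for (@idfun R)}).
Local Notation "''s_' a" := (root_reflection ip a) (at level 8, a at level 2).
Local Notation cartan := (cartan ip).
Local Notation coroot := (coroot ip).
Implicit Types (Phi : seq V) (a b g : V).

Record root_system Phi : Prop := {
  root_neq0 : {in Phi, forall a, a != 0};
  root_refl : {in Phi &, forall a b, 's_a b \in Phi};
  root_reduced : reduced_roots Phi;
  root_cryst : crystallographic ip Phi }.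

(** Duality for root systems: part of the argument is run once for Phi and once
    for its coroots. *)
Lemma coroot_system Phi : root_system Phi -> root_system (map coroot Phi).
Proof.
move=> RS; have nz := root_neq0 RS; split=> [_ /mapP[a aP ->]|||].
- exact/coroot_neq0/nz.
- move=> _ _ /mapP[a aP ->] /mapP[b bP ->]; rewrite refl_coroot ?nz //.
  rewrite (coroot_isometry (f := 's_a)) ?refl_ip //; last exact: reflZr.
  exact/map_f/(root_refl RS).
- move=> _ /mapP[a aP ->] c /mapP[b bP E].
  have [a0 b0] := (ip_neq0 ip (nz _ aP), ip_neq0 ip (nz _ bP)).
  have c0 : c != 0.
    apply: contraTneq (coroot_neq0 ip (nz _ bP)) => c0.
    by rewrite -E c0 scale0r eqxx.
  have {}E : b = c^-1 *: a.
    rewrite -(corootK ip (nz _ bP)) -E {1}/coroot ipZl ipZr coroot_ip ?nz //.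
    rewrite /coroot !scalerA; congr (_ *: _); by field; rewrite a0 c0.
  have [] := root_reduced RS aP (c := c^-1); first by rewrite -E.
    by move/(congr1 GRing.inv); rewrite invrK invr1; left.
  by move/(congr1 GRing.inv); rewrite invrK invrN1; right.
- move=> _ _ /mapP[a aP ->] /mapP[b bP ->].
  have := cartan_coroot ip (nz _ aP) (nz _ bP); rewrite {1}/cartan => ->.
  exact: root_cryst bP aP.
Qed.

Lemma root_cartan Phi a b : root_system Phi -> a \in Phi -> b \in Phi ->
  exists m : int, cartan a b = m%:~R.
Proof. by move=> RS aP bP; apply/intrP/(root_cryst RS). Qed.

Lemma zspan_refl Phi (s : seq V) a b : root_system Phi -> a \in Phi ->
  b \in Phi -> zspan s a -> zspan s b -> zspan s ('s_a b).
Proof.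
move=> RS aP bP sa sb; have [m Em] := root_cartan RS aP bP.
by rewrite reflE Em -scale_intr; apply: zspanD => //; apply/zspanN/zspanMz.
Qed.

(** Cauchy-Schwarz, in the form of its defect. *)
Lemma cartan_mul_defect a b : a != 0 -> b != 0 ->
  let u := b - (ip a b / ip a a) *: a in
  cartan a b * cartan b a = 4 - 4 * ip u u / ip b b.
Proof.
move=> /(ip_neq0 ip) a0 /(ip_neq0 ip) b0 /=.
rewrite /cartan !ipE (ipC ip b a); by field; rewrite a0 b0.
Qed.

(** The two Cartan integers of a and b have the same sign and, by the strict
    Cauchy-Schwarz inequality, a product less than 4.  So the one belonging to
    the longer root is a sign, and the other is, up to sign, the ratio of the
    squared lengths. *)
Lemma cartan_pair Phi a b : root_system Phi -> a \in Phi -> b \in Phi ->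
    ip a b != 0 -> ip a a <= ip b b -> b != a -> b != - a ->
  cartan b a = Num.sg (ip a b) /\
  exists2 n : nat, (1 <= n <= 3)%N & ip b b = n%:R * ip a a.
Proof.
move=> RS aP bP ab le_ab ba bNa; have nz := root_neq0 RS.
have [a0 b0] := (nz _ aP, nz _ bP).
have [m Em] := root_cartan RS bP aP; have [n En] := root_cartan RS aP bP.
have [pa pb] := (ip_gt0 ip a0, ip_gt0 ip b0).
have lt4 : cartan a b * cartan b a < 4.
  rewrite cartan_mul_defect // ltrBlDr ltrDl; apply: divr_gt0 => //.
  apply: mulr_gt0 => //; apply: ip_gt0; apply/eqP => /subr0_eq E.
  have [] := root_reduced RS aP (c := ip a b / ip a a); first by rewrite -E.
    by move=> c1; move: ba; rewrite E c1 scale1r eqxx.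
  by move=> c1; move: bNa; rewrite E c1 scaleN1r eqxx.
have Emn : (m%:~R : R) * ip b b = n%:~R * ip a a.
  rewrite -Em -En /cartan (ipC ip b a); field.
  by rewrite !lt0r_neq0.
have EMN : (`|m|%N%:R : R) * ip b b = `|n|%N%:R * ip a a.
  rewrite !natr_absz !intr_norm -{1}(gtr0_norm pb) -{1}(gtr0_norm pa).
  by rewrite -!normrM Emn.
have mn_gt0 : 0 < (n%:~R : R) * m%:~R.
  rewrite -Em -En /cartan (ipC ip b a) mulf_div.
  apply: divr_gt0; last exact: mulr_gt0.
  by rewrite -expr2 exprn_even_gt0 //= mulf_neq0 // pnatr_eq0.
have {lt4} lt4 : (n * m < 4)%R by rewrite -(ltr_int R) intrM -Em -En.
have {}mn_gt0 : (0 < n * m)%R by rewrite -(ltr_int R) intrM.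
have leMN : (`|m| <= `|n|)%N.
  rewrite -(ler_nat R) -(ler_pM2r pb) EMN ler_pM2l // ltr0n absz_gt0.
  apply: contraTneq mn_gt0 => n0.
  by rewrite n0 mul0r ltxx.
have NM : (0 < `|n| * `|m| < 4)%N.
  by rewrite -abszM; move: mn_gt0 lt4; clear; lia.
have M1 : `|m|%N = 1%N by move: leMN NM; clear; nia.
split; first last.
  by exists `|n|%N; [move: NM; rewrite M1 muln1 | rewrite -EMN M1 mul1r].
have -> : Num.sg (ip a b) = Num.sg (m%:~R * ip b b).
  rewrite -Em /cartan (ipC ip b a) mulfVK; last exact: lt0r_neq0.
  by rewrite sgrM (gtr0_sg (ltr0Sn _ 1)) mul1r.
rewrite sgrM (gtr0_sg pb) mulr1 Em; case: (m) M1 => [] [|[|k]] //= _.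
  by rewrite sgr1.
by rewrite sgrN1.
Qed.

Lemma nonorthogonal_ratio Phi a b : root_system Phi -> a \in Phi ->
    b \in Phi -> ip a b != 0 -> ip a a <= ip b b ->
  exists2 n : nat, (1 <= n <= 3)%N & ip b b = n%:R * ip a a.
Proof.
move=> RS aP bP ab leab; have [->|ba] := eqVneq b a.
  by exists 1%N; rewrite ?mul1r.
have [->|bNa] := eqVneq b (- a).
  by exists 1%N; rewrite // !ipE opprK mul1r.
by have [] := cartan_pair RS aP bP ab leab ba bNa.
Qed.

(** If a is orthogonal to c, reflecting it in b adds a nonzero multiple of b.
    This replaces irreducibility: along a chain of nonorthogonal roots, each
    root is nonorthogonal to one of the length of the first. *)
Lemma nonorthogonal_bridge Phi a b c : root_system Phi -> a \in Phi ->
    b \in Phi -> ip a b != 0 -> ip b c != 0 ->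
  exists a', [/\ a' \in Phi, ip a' a' = ip a a & ip a' c != 0].
Proof.
move=> RS aP bP ab bc; have [ac|ac] := eqVneq (ip a c) 0; last by exists a.
exists ('s_b a); split; [exact: (root_refl RS) | exact: refl_ip |].
rewrite reflE !ipE ac sub0r oppr_eq0 mulf_neq0 // /cartan ipC.
by rewrite !mulf_neq0 ?invr_eq0 ?pnatr_eq0 ?(ip_neq0 ip (root_neq0 RS bP)).
Qed.

(** Minimality of length is asked for only among the roots that are not
    orthogonal to b, so that no decomposition into irreducible components is
    needed. *)
Definition short Phi b := {in Phi, forall g, ip b g != 0 -> ip b b <= ip g g}.

Lemma short_refl Phi a b : root_system Phi -> a \in Phi ->
  short Phi b -> short Phi ('s_a b).
Proof.
move=> RS aP sb g gP; rewrite refl_ip -{1}['s_a b]/('s_a b).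
rewrite -(refl_ip ip a) reflK => /sb; rewrite refl_ip; apply.
exact: (root_refl RS).
Qed.

(** Otherwise b is nonorthogonal to a shorter g and to a longer d.  After
    replacing g by a root of the same length that is not orthogonal to d, the
    ratio of the squared lengths of d and g is at most 3, yet it is a product of
    two ratios that are each at least 2. *)
Lemma short_or_long Phi b : root_system Phi -> b \in Phi ->
  short Phi b \/ short (map coroot Phi) (coroot b).
Proof.
move=> RS bP; have nz := root_neq0 RS; apply: contrapT => /not_orP[].
move=> /existsNP[g] /not_implyP[gP] /not_implyP[bg /negP]; rewrite -ltNge => ltgb.
move=> /existsNP[dv] /not_implyP[/mapP[d dP ->]].
have [pb pd pg] :
  [/\ 0 < ip b b, 0 < ip d d & 0 < ip g g] by split; apply/ip_gt0/nz.
rewrite !coroot_ip ?nz // => /not_implyP[bd /negP].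
have normv v : v \in Phi -> 4 * ip v v / (ip v v * ip v v) = 4 / ip v v.
  by move=> /nz/(ip_neq0 ip) v0; field.
rewrite !normv // -ltNge ltr_pM2l ?ltr0n // ltf_pV2 ?posrE // => ltbd.
have {}bd : ip b d != 0.
  by apply: contraNneq bd => ->; rewrite mulr0 mul0r.
have {}bg : ip g b != 0 by rewrite ipC.
have [g' [g'P Eg g'd]] := nonorthogonal_bridge RS gP bP bg bd.
have [m _ Em] := nonorthogonal_ratio RS gP bP bg (ltW ltgb).
have [n _ En] := nonorthogonal_ratio RS bP dP bd (ltW ltbd).
have leg'd : ip g' g' <= ip d d by rewrite Eg; apply/ltW/(lt_trans ltgb).
have [k /andP[_ k3] Ek] := nonorthogonal_ratio RS g'P dP g'd leg'd.
have : k%:R * ip g g = (n * m)%:R * ip g g.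
  by rewrite -Eg -Ek En Em Eg natrM mulrA.
move/(mulIf (lt0r_neq0 pg))/eqP; rewrite eqr_nat => /eqP kE.
have m1 : (1 < m)%N by rewrite -(ltr_nat R) -(ltr_pM2r pg) mul1r -Em.
have n1 : (1 < n)%N by rewrite -(ltr_nat R) -(ltr_pM2r pb) mul1r -En.
by have := leq_mul n1 m1; rewrite -kE => /leq_trans/(_ k3).
Qed.

(** With b = sum_i a_i s_i over the entries s_i of s, positivity of (b | b)
    gives i with a_i (s_i | b) > 0.  If b is not +- s_i, shortness makes the Cartan integer
    a sign, so the reflection in s_i subtracts s_i or - s_i from b and the sum
    of the |a_i| drops by 1.  In the application P b says that the reflection in
    b belongs to the group generated by those in s. *)
Lemma short_root_descent Phi (s : seq V) (P : V -> Prop) b :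
    root_system Phi -> {subset s <= Phi} -> {in s, forall a, P a} ->
    {in s & Phi, forall a c, P ('s_a c) -> P c} ->
    (forall a, P a -> P (- a)) ->
  b \in Phi -> short Phi b -> zspan s b -> P b.
Proof.
move=> RS sP Ps Prefl PN bP sb [a Eb].
have [n len] : exists n, (\sum_(i < size s) `|a i| < n)%N by eexists.
elim: n => // n IHn in b a Eb len bP sb *.
have nz := root_neq0 RS.
have [i ai] : exists i, 0 < (a i)%:~R * ip s`_i b.
  apply: contrapT => /forallNP all_le; have := ip_gt0 ip (nz _ bP).
  rewrite {1}Eb ip_suml ltNge => /negP; apply; apply: sumr_le0 => i _.
  by rewrite scale_intr ipZl leNgt; apply/negP.
have siP : s`_i \in Phi by rewrite sP ?mem_nth.
have [Ebi|bi] := eqVneq b s`_i; first by rewrite Ebi; apply/Ps/mem_nth.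
have [Ebi|bNi] := eqVneq b (- s`_i).
  by rewrite Ebi; apply/PN/Ps/mem_nth.
have bs0 : ip b s`_i != 0.
  by apply: contraTneq ai; rewrite ipC => ->; rewrite mulr0 ltxx.
have ai0 : a i != 0 by apply: contraTneq ai => ->; rewrite mul0r ltxx.
have [||Ec _] := cartan_pair RS bP siP bs0 (sb _ siP bs0).
  by rewrite eq_sym.
  by rewrite -eqr_oppLR eq_sym.
have sgE : Num.sg (ip b s`_i) = (Num.sg (a i))%:~R.
  have := gtr0_sg ai; rewrite sgrM -intr_sg ipC.
  case: (ltrgt0P (ip b s`_i)) bs0 => [x0|x0|//] _.
    by rewrite (gtr0_sg x0) mulr1.
  by rewrite (ltr0_sg x0) mulrN1 => /(congr1 -%R); rewrite opprK.
(* The coordinates of the reflected root. *)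
pose a' := [ffun j => if j == i then a i - Num.sg (a i) else a j].
apply: (Prefl s`_i) => //; first exact: mem_nth.
apply: (IHn _ a'); last 2 first.
- exact: (root_refl RS).
- exact: short_refl.
- rewrite reflE Ec sgE -scale_intr Eb (bigD1 i) // [RHS](bigD1 i) //=.
  rewrite ffunE eqxx mulrzBr addrAC.
  by congr (_ + _); apply: eq_bigr => j /negPf ji; rewrite ffunE ji.
- rewrite -ltnS; apply: leq_trans len; rewrite ltnS.
  rewrite [X in (X < _)%N](bigD1 i) //.
  rewrite [X in (_ <= X)%N](bigD1 i) //= ffunE eqxx -addSn leq_add //.
    by move: ai0; case: (a i) => [] [|k] //=; lia.
  by apply: leq_sum => j /negPf ji; rewrite ffunE ji.
Qed.

End RootSystem.

(** * Integral relations between roots *)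

Lemma exists_Bezout n (c : 'I_n -> int) :
  exists h : 'I_n -> int, forall i, (\sum_j h j * c j %| c i)%Z.
Proof.
elim: n c => [|n IHn] c; first by exists (fun=> 0) => -[].
have [h hP] := IHn (fun i => c (lift ord0 i)).
pose g := \sum_j h j * c (lift ord0 j).
have [u [v uv]] := Bezoutz (c ord0) g.
exists (fun i => if unlift ord0 i is Some j then v * h j else u) => i.
rewrite big_ord_recl unlift_none.
under eq_bigr do rewrite liftK -mulrA.
rewrite -mulr_sumr -/g uv.
case: (unliftP ord0 i) => [j ->|->]; last exact: dvdz_gcdl.
exact: dvdz_trans (dvdz_gcdr _ _) (hP j).
Qed.

Section IntegralFamily.
Variables (R : realType) (V : vectType R) (ip : {dot V for (@idfun R)}).
Local Notation "''s_' a" := (root_reflection ip a) (at level 8, a at level 2).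
Local Notation cartan := (cartan ip).
Local Notation coroot := (coroot ip).

(** What the affine argument needs of roots: a nonzero family with integral
    Cartan matrix, in which repetitions and sign changes are allowed. *)
Definition integral_family (I : finType) (r : I -> V) :=
  forall i, r i != 0 /\ forall j, cartan (r i) (r j) \is a Num.int.

Lemma root_integral_family Phi (I : finType) (r : I -> V) :
  root_system ip Phi -> (forall i, r i \in Phi) -> integral_family r.
Proof.
move=> RS rP i; split=> [|j]; first exact: (root_neq0 RS).
exact: (root_cryst RS).
Qed.

Lemma integral_coroot (I : finType) (r : I -> V) :
  integral_family r -> integral_family (coroot \o r).
Proof.
move=> ir i; split=> [|j /=]; first exact/coroot_neq0/(ir i).1.
by rewrite cartan_coroot ?(ir _).1 //; apply: (ir j).2.
Qed.

(** While some value h_i = (x | r_i) + D is negative, reflect x in the wall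
    where it vanishes, that is, subtract h_i r_i^v from x.  The values stay
    integral, and |x|^2 changes by 4 D h_i / |r_i|^2; as h_i <= -1, it drops by
    at least 4 D / M where M bounds the |r_i|^2, so the process stops. *)
Lemma integral_affine_chamber (I : finType) (r : I -> V) (D : R) (x : V) :
    integral_family r -> 0 < D -> (forall i, ip x (r i) + D \is a Num.int) ->
  exists y, forall i, ip y (r i) + D \is a Num.nat.
Proof.
move=> ir D0; pose M := 1 + \sum_i ip (r i) (r i).
have r0 i : 0 < ip (r i) (r i) by apply/ip_gt0/(ir i).1.
have leM i : ip (r i) (r i) <= M.
  rewrite /M (bigD1 i) //= addrCA lerDl addr_ge0 // sumr_ge0 // => j _.
  exact: ltW.
have M0 : 0 < M by rewrite ltr_wpDr // sumr_ge0 // => j _; apply: ltW.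
pose e := 4 * D / M; have e0 : 0 < e by rewrite divr_gt0 // mulr_gt0.
have [n] : exists n : nat, ip x x < e * n%:R.
  exists (Num.bound (ip x x / e)); rewrite mulrC -ltr_pdivrMr //.
  have [->|/(ip_gt0 ip)/ltW x0] := eqVneq x 0; last first.
    by apply: archi_boundP; rewrite divr_ge0 // ltW.
  by rewrite ip0l mul0r archi_boundP.
elim: n x => [|n IHn] x ltx xint.
  have [x0|/(ip_gt0 ip)/lt_gtF] := eqVneq x 0; last by rewrite -[0](mulr0 e) ltx.
  by move: ltx; rewrite x0 ip0l mulr0 ltxx.
have [[i neg]|nneg] := pselect (exists i, ip x (r i) + D < 0); last first.
  exists x => i; rewrite natrEint xint leNgt /=.
  by apply/negP => neg; apply: nneg; exists i.
pose h := ip x (r i) + D.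
have hN1 : h <= -1.
  have /intrP[m Em] := xint i; rewrite /h Em -[-1]/((-1)%:~R) ler_int.
  by move: neg; rewrite Em ltrz0; lia.
apply: (IHn (x - h *: coroot (r i))) => [|j]; last first.
  rewrite ipDl ipNl ipZl addrAC; apply: rpredB; first exact: xint.
  apply: rpredM; first exact: xint.
  suff -> : ip (coroot (r i)) (r j) = cartan (r i) (r j) by apply: (ir i).2.
  by rewrite ipZl mulrAC.
have ri0 := lt0r_neq0 (r0 i).
have -> : ip (x - h *: coroot (r i)) (x - h *: coroot (r i))
    = ip x x + 4 * D / ip (r i) (r i) * h.
  by rewrite /coroot !ipE (ipC ip (r i) x) /h; field.
(* The decrease is at least e, whichever wall is used. *)
have le_e : e <= 4 * D / ip (r i) (r i).
  by rewrite ler_pM2l ?mulr_gt0 // lef_pV2 // posrE.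
have : 4 * D / ip (r i) (r i) * h <= - (4 * D / ip (r i) (r i)).
  by rewrite -mulrN1 ler_pM2l // divr_gt0 // mulr_gt0.
move: ltx; rewrite -natr1 mulrDr mulr1; lra.
Qed.

(** Freeness over the integers for indexed families, where a submatrix or a
    coroot family is easier to form than with lists. *)
Definition int_free m (r : 'I_m -> V) :=
  forall y : 'I_m -> int, \sum_i r i *~ y i = 0 -> forall i, y i = 0.

Definition cartan_matrix m (r : 'I_m -> V) : 'M[int]_m :=
  \matrix_(j, i) Num.floor (cartan (r i) (r j)).

Lemma cartan_matrixE m (r : 'I_m -> V) i j : integral_family r ->
  (cartan_matrix r j i)%:~R = cartan (r i) (r j).
Proof. by move=> /(_ i)[_ /(_ j)]; rewrite mxE => /floorK. Qed.

Lemma cartan_sum m (r : 'I_m -> V) (y : 'I_m -> R) i : integral_family r ->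
  \sum_j y j * (cartan_matrix r j i)%:~R
    = 2 / ip (r i) (r i) * ip (\sum_j y j *: r j) (r i).
Proof.
move=> ir; rewrite ip_suml mulr_sumr; apply: eq_bigr => j _.
by rewrite cartan_matrixE // /cartan ipZl (ipC ip (r j)); ring.
Qed.

(** An integral vector in the kernel of the Cartan matrix is a combination of
    the r_i orthogonal to all r_i, hence zero.  In particular freeness over the
    integers is freeness over the reals. *)
Lemma int_free_det m (r : 'I_m -> V) : integral_family r ->
  int_free r <-> \det (cartan_matrix r) != 0.
Proof.
move=> ir; have relE (y : 'I_m -> int) :
    \sum_i r i *~ y i = \sum_i (y i)%:~R *: r i.
  by apply: eq_bigr => i _; rewrite scale_intr.
have orth (y : 'I_m -> int) i :
    (\sum_j y j * cartan_matrix r j i == 0)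
      = (ip (\sum_j r j *~ y j) (r i) == 0).
  have ri0 : 2 / ip (r i) (r i) != 0.
    by rewrite mulf_neq0 ?invr_eq0 ?pnatr_eq0 // ip_neq0 // (ir i).1.
  rewrite relE -[RHS](mulrI_eq0 _ (mulfI ri0)) -cartan_sum // -(intr_eq0 R).
  by rewrite rmorph_sum /=; under eq_bigr do rewrite intrM.
split=> [fr|det0 y rel i].
  apply/det0P => -[y /eqP y0 yA]; apply: y0; apply/rowP => i; rewrite mxE.
  apply: (fr (y 0)); apply: (ip_eq0 (ip := ip)); set u := \sum_j _.
  rewrite {1}/u ip_suml big1 // => j _; rewrite scale_intr ipZl ipC.
  have /eqP -> : ip u (r j) == 0; last by rewrite mulr0.
  by rewrite -orth; apply/eqP; have /rowP/(_ j) := yA; rewrite !mxE.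
apply: contraNeq det0 => yi; apply/det0P; exists (\row_j y j).
  by apply: contraNneq yi => /rowP/(_ i); rewrite !mxE => ->.
apply/rowP => j; rewrite !mxE; under eq_bigr do rewrite mxE.
by apply/eqP; rewrite orth rel ip0l.
Qed.

(** The Cartan matrix of the coroots is the transpose. *)
Lemma int_free_coroot m (r : 'I_m -> V) : integral_family r ->
  int_free r -> int_free (coroot \o r).
Proof.
move=> ir /(int_free_det ir) det0; apply/int_free_det.
  exact: integral_coroot.
suff -> : cartan_matrix (coroot \o r) = (cartan_matrix r)^T by rewrite det_tr.
by apply/matrixP => j i; rewrite !mxE /= cartan_coroot ?(ir _).1.
Qed.

Lemma int_free_solve m (r : 'I_m -> V) (b : 'I_m -> R) :
  integral_family r -> int_free r -> exists x, forall i, ip x (r i) = b i.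
Proof.
move=> ir /(int_free_det ir) det0.
pose A := map_mx (intr : int -> R) (cartan_matrix r).
have uA : A \in unitmx by rewrite unitmxE det_map_mx unitfE intr_eq0.
pose y := (\row_i (2 / ip (r i) (r i) * b i)) *m invmx A.
exists (\sum_j y 0 j *: r j) => i.
have ri0 : 2 / ip (r i) (r i) != 0.
  by rewrite mulf_neq0 ?invr_eq0 ?pnatr_eq0 // ip_neq0 // (ir i).1.
apply: (mulfI ri0); rewrite -cartan_sum //.
have /rowP/(_ i) : y *m A = \row_i (2 / ip (r i) (r i) * b i) by rewrite mulmxKV.
by rewrite !mxE => <-; apply: eq_bigr => j _; rewrite [A _ _]mxE.
Qed.

(** A relation that is unique up to scalars, since the family without its
    first vector is free; coefficients other than the first may vanish. *)
Definition circuit m (r : 'I_m.+1 -> V) (c : 'I_m.+1 -> int) :=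
  [/\ int_free (r \o lift ord0), c ord0 != 0 & \sum_i r i *~ c i = 0].

(** The constant D = g / sum_i c_i makes (x | r_i) + D = h_i solvable for
    every h with sum_i c_i h_i = g: the r_i without the first are independent,
    and the equation for the first follows from the relation.  In the chamber
    the h_i are natural numbers and c_k <= c_k h_k <= g for some k. *)
Lemma nneg_circuit_divisor m (r : 'I_m.+1 -> V) (c : 'I_m.+1 -> int) :
    integral_family r -> circuit r c -> (forall i, 0 <= c i) ->
  exists2 k, c k != 0 & forall i, (c k %| c i)%Z.
Proof.
move=> ir [fr c0 rel] c_ge0; have [h0 gP0] := exists_Bezout c.
pose g := `|\sum_j h0 j * c j|.
have [h Eg] : exists h : 'I_m.+1 -> int, \sum_j h j * c j = g.
  (* Bezout gives the gcd only up to sign. *)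
  exists (fun j => Num.sg (\sum_j h0 j * c j) * h0 j).
  by under eq_bigr do rewrite -mulrA; rewrite -mulr_sumr -normrEsg.
have gP i : (g %| c i)%Z by have := gP0 i; rewrite /g /dvdz normrEsign abszMsign.
have g0 : 0 < g.
  by rewrite normr_gt0; apply: contraNneq c0 => g0; rewrite -dvd0z -g0.
have C0 : 0 < \sum_i c i.
  rewrite (bigD1 ord0) //= ltr_pwDl ?sumr_ge0 // lt_def c0; exact: c_ge0.
pose D : R := g%:~R / (\sum_i c i)%:~R.
have D0 : 0 < D by rewrite divr_gt0 ?ltr0z.
have DC : D * (\sum_i c i)%:~R = g%:~R by rewrite mulfVK // intr_eq0 gt_eqF.
have ip_rel x : \sum_i (c i)%:~R * ip x (r i) = 0.
  rewrite -[RHS](ip0l ip x) -rel ip_suml; apply: eq_bigr => i _.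
  by rewrite scale_intr ipZl ipC.
have [||x xP] :=
  @int_free_solve _ (r \o lift ord0) (fun i => (h (lift ord0 i))%:~R - D).
- by move=> i; split=> [|j]; [exact: (ir _).1 | exact: (ir _).2].
- exact: fr.
have {}xP i : ip x (r i) + D = (h i)%:~R.
  case: (unliftP ord0 i) => [j ->|->]; first by have /= -> := xP j; rewrite subrK.
  have c0R : ((c ord0)%:~R : R) != 0 by rewrite intr_eq0.
  apply: (mulfI c0R); rewrite mulrDr; have := ip_rel x; rewrite big_ord_recl.
  under eq_bigr do rewrite [ip x _]xP mulrBr -intrM.
  rewrite sumrB -rmorph_sum -mulr_suml -rmorph_sum /= => /eqP.
  rewrite addr_eq0 => /eqP ->.
  have := DC; rewrite -Eg !big_ord_recl /= [RHS]intrD intrM.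
  have -> : \sum_(i < m) h (lift ord0 i) * c (lift ord0 i) =
    \sum_(i < m) c (lift ord0 i) * h (lift ord0 i).
    by apply: eq_bigr => j _; rewrite mulrC.
  rewrite intrD; lra.
have [|y yP] := @integral_affine_chamber _ r D x ir D0.
  by move=> i; rewrite xP intr_int.
have /fin_all_exists[n nP] i : exists n, ip y (r i) + D = n%:R by exact/natrP.
have Eg' : \sum_i c i * (n i)%:Z = g.
  apply/eqP; rewrite -(eqr_int R) rmorph_sum /= -DC.
  under eq_bigr do rewrite intrM -pmulrn -nP mulrDr.
  by rewrite big_split /= ip_rel add0r -mulr_suml -rmorph_sum mulrC.
have [k ck] : exists k, c k * (n k)%:Z != 0.
  apply: contrapT => /forallNP all0; move: g0; rewrite -Eg' big1 ?ltxx // => i _.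
  by apply/eqP; apply: contraT => /all0.
have le_g : c k * (n k)%:Z <= g.
  rewrite -Eg' (bigD1 k) //= lerDl sumr_ge0 // => i _.
  by rewrite mulr_ge0.
have ck0 : c k != 0 by apply: contraNneq ck => ->; rewrite mul0r.
exists k => // i; suff -> : c k = g by [].
have nk0 : n k != 0%N by apply: contraNneq ck => ->; rewrite mulr0.
have ck_gt0 : 0 < c k by rewrite lt_def ck0 c_ge0.
apply/eqP; rewrite eq_le (le_trans _ le_g) /=; last first.
  by rewrite ler_peMr ?c_ge0 //; move: nk0; clear; lia.
have /dvdzP[q Eq] := gP k; rewrite Eq; apply: ler_peMl; first exact: ltW.
move: ck_gt0; rewrite Eq pmulr_lgt0 // gtz0_ge1.
Qed.

Lemma circuit_divisor m (r : 'I_m.+1 -> V) (c : 'I_m.+1 -> int) :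
    integral_family r -> circuit r c ->
  exists2 k, c k != 0 & forall i, (c k %| c i)%Z.
Proof.
move=> ir [fr c0 rel].
(* Changing signs of the vectors makes all coefficients nonnegative. *)
pose r' i := if c i < 0 then - r i else r i.
have ir' : integral_family r'.
  move=> i; rewrite /r'; split=> [|j].
    by case: ifP; rewrite ?oppr_eq0 (ir i).1.
  have := (ir i).2 j; rewrite /cartan.
  by do 2!case: ifP => _; rewrite ?ipE ?opprK ?mulrN ?mulNr ?rpredN.
have flip i (z : int) : r' i *~ z = r i *~ (if c i < 0 then - z else z).
  by rewrite /r'; case: ifP; rewrite // mulNrz mulrNz.
have cabs i : `|c i| = (if c i < 0 then - c i else c i).
  by case: ltrP => [/ltr0_norm|/ger0_norm].
have circ' : circuit r' (fun i => `|c i|).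
  split; [move=> y rel' i | by rewrite normr_eq0 |].
    have /fr/(_ i) : \sum_j (r \o lift ord0) j *~
        (if c (lift ord0 j) < 0 then - y j else y j) = 0.
      by rewrite -[RHS]rel'; apply: eq_bigr => j _; rewrite -flip.
    by case: ifP => // _ /eqP; rewrite oppr_eq0 => /eqP.
  rewrite -[RHS]rel; apply: eq_bigr => i _; rewrite flip cabs.
  by case: (c i < 0); rewrite ?opprK.
have [|k ck kP] := nneg_circuit_divisor ir' circ'; first by move=> i.
exists k; first by rewrite -normr_eq0.
by move=> i; have := kP i; rewrite !dvdzE !absz_id.
Qed.

Lemma circuit_unique m (r : 'I_m.+1 -> V) (c : 'I_m.+1 -> int) :
    int_free (r \o lift ord0) -> c ord0 = 0 ->
  \sum_i r i *~ c i = 0 -> forall i, c i = 0.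
Proof.
move=> fr c0; rewrite big_ord_recl c0 mulr0z add0r => /fr c'0 i.
by case: (unliftP ord0 i) => [j ->|->].
Qed.

(** Let J be the indices whose root is nonorthogonal to some root of the length
    of r_i.  Roots inside J are orthogonal to those outside, so the parts of the
    relation on J and off J vanish separately; by uniqueness one of them has
    only zero coefficients, and it is not the part on J, which contains i. *)
Lemma circuit_connected Phi m (r : 'I_m.+1 -> V) (c : 'I_m.+1 -> int) i j :
    root_system ip Phi -> (forall i, r i \in Phi) -> circuit r c ->
    c i != 0 -> c j != 0 ->
  exists a, [/\ a \in Phi, ip a a = ip (r i) (r i) & ip a (r j) != 0].
Proof.
move=> RS rP [fr c0 rel] ci cj.
pose J k := `[< exists a, [/\ a \in Phi, ip a a = ip (r i) (r i)
                            & ip a (r k) != 0] >].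
have Jclosed k l : J k -> ip (r k) (r l) != 0 -> J l.
  move=> /asboolP[a [aP Ea ak]] kl; apply/asboolP.
  have [a' [? Ea' ?]] := nonorthogonal_bridge RS aP (rP k) ak kl.
  by exists a'; rewrite Ea' Ea.
have Ji : J i.
  by apply/asboolP; exists (r i); rewrite rP ip_neq0 ?(root_neq0 RS).
pose cJ k := if J k then c k else 0; pose cN k := if J k then 0 else c k.
pose u := \sum_k r k *~ cJ k; pose v := \sum_k r k *~ cN k.
have uv0 : u + v = 0.
  rewrite -[RHS]rel -big_split; apply: eq_bigr => k _ /=; rewrite -mulrzDr.
  by rewrite /cJ /cN; case: ifP => _; rewrite ?addr0 ?add0r.
have ipuv : ip u v = 0.
  rewrite ip_suml big1 // => k _; rewrite ipC ip_suml big1 // => l _.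
  rewrite !scale_intr !ipE /cJ /cN.
  case: ifP => Jl; first by rewrite mul0r.
  case: ifP => Jk; last by rewrite mul0r mulr0.
  suff /eqP -> : ip (r l) (r k) == 0 by rewrite !mulr0.
  by apply: contraFT Jl => /= kl; apply: Jclosed Jk _; rewrite ipC.
have v0 : v = 0.
  apply: (ip_eq0 (ip := ip)); rewrite -[RHS]oppr0 -ipuv -ipNl.
  by congr (ip _ v); apply/eqP; rewrite -addr_eq0 addrC uv0.
have u0 : u = 0 by rewrite -uv0 v0 addr0.
apply/asboolP; rewrite -/(J j); apply: contraNT cj => NJj; apply/eqP.
have [J0|NJ0] := boolP (J ord0).
  have := circuit_unique fr _ v0 j; rewrite /cN J0 (negPf NJj); exact.
have := circuit_unique fr _ u0 i; rewrite /cJ (negPf NJ0) Ji => /(_ erefl) ci0.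
by rewrite ci0 eqxx in ci.
Qed.

(** Relative to the shortest vector of the support the squared lengths are 1, 2
    or 3, and 2 and 3 cannot both occur, because 3/2 is not an admissible
    ratio.  Off the support N is set to 1. *)
Lemma circuit_two_lengths Phi m (r : 'I_m.+1 -> V) (c : 'I_m.+1 -> int) :
    root_system ip Phi -> (forall i, r i \in Phi) -> circuit r c ->
  exists (p : nat) (q : R) (N : 'I_m.+1 -> nat), [/\ prime p, q != 0,
    forall i, N i = 1%N \/ N i = p &
    forall i, c i != 0 -> ip (r i) (r i) = (N i)%:R * q].
Proof.
move=> RS rP circ; have [_ c0 _] := circ.
have r0 i : 0 < ip (r i) (r i) by apply/ip_gt0/(root_neq0 RS).
have ratio i j : c i != 0 -> c j != 0 -> ip (r i) (r i) <= ip (r j) (r j) ->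
    exists2 n : nat, (1 <= n <= 3)%N & ip (r j) (r j) = n%:R * ip (r i) (r i).
  move=> ci cj; have [a [aP <- aj]] := circuit_connected RS rP circ ci cj.
  exact: nonorthogonal_ratio RS aP (rP j) aj.
case: (@arg_minP _ _ _ ord0 (fun i => c i != 0) (fun i => ip (r i) (r i)) c0).
move=> i0 ci0 min_i0; set q := ip (r i0) (r i0).
have /fin_all_exists[N NP] i : exists n : nat, if c i == 0 then n = 1%N else
    (1 <= n <= 3)%N /\ ip (r i) (r i) = n%:R * q.
  case: eqVneq => ci; first by exists 1%N.
  by have [n] := ratio i0 i ci0 ci (min_i0 i ci); exists n.
have no23 i j : N i = 2%N -> N j = 3%N -> False.
  move=> Ni Nj; have := NP i; have := NP j; rewrite Ni Nj.
  case: ifPn => // cj [_ Ej]; case: ifPn => // ci [_ Ei].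
  have [|n _] := ratio i j ci cj.
    by rewrite Ei Ej (ler_pM2r (r0 i0)) ler_nat.
  rewrite Ei Ej mulrA -natrM => /(mulIf (lt0r_neq0 (r0 i0)))/eqP.
  by rewrite eqr_nat => /eqP; lia.
have Nle i : (1 <= N i <= 3)%N.
  by have := NP i; case: ifP => [_ ->|_ []].
exists (if [exists i, N i == 3] then 3 else 2)%N, q, N; split.
- by case: ifP.
- exact: lt0r_neq0 (r0 i0).
- move=> i; have := Nle i; case: ifP => [/existsP[j /eqP /no23 N3]|/existsPn N3].
    by have := N3 i; case: (N i) => [|[|[|[|]]]] //; auto.
  by have := N3 i; case: (N i) => [|[|[|[|]]]] //; auto.
- by move=> i /negPf ci; have := NP i; rewrite ci => -[].
Qed.

Lemma circuit_coroot m (r : 'I_m.+1 -> V) (c : 'I_m.+1 -> int)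
    (N : 'I_m.+1 -> nat) (q : R) :
    integral_family r -> q != 0 -> (forall i, N i != 0%N) ->
    (forall i, c i != 0 -> ip (r i) (r i) = (N i)%:R * q) ->
  circuit r c -> circuit (coroot \o r) (fun i => c i * (N i)%:Z).
Proof.
move=> ir q0 N0 NP [fr c0 rel]; split; first 1 last.
- by rewrite mulf_neq0 // N0.
- transitivity ((2 / q) *: \sum_i r i *~ c i); last by rewrite rel scaler0.
  rewrite scaler_sumr; apply: eq_bigr => i _.
  have [->|ci] := eqVneq (c i) 0; first by rewrite mul0r !mulr0z scaler0.
  rewrite !scale_intr /= /coroot !scalerA NP //; congr (_ *: _).
  have Ni0 : ((N i)%:R : R) != 0 by rewrite pnatr_eq0.
  by rewrite intrM -pmulrn; field; apply/andP.
- apply: (int_free_coroot (r := r \o lift ord0)) => // i.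
  by split=> [|j]; [exact: (ir _).1 | exact: (ir _).2].
Qed.

(** Let k and l be the indices found for roots and for coroots, with dual
    coefficients c_i N_i.  Writing c_l = z c_k, the choice of l gives
    z N_l | N_k, which is 1 or p.  If z is a unit, l is good for the roots too.
    Otherwise |z| = N_k = p, and c_k N_k divides c_l, so k is good for the
    coroots too. *)
Lemma circuit_common_divisor Phi m (r : 'I_m.+1 -> V) (c : 'I_m.+1 -> int) :
    root_system ip Phi -> (forall i, r i \in Phi) -> circuit r c ->
  exists k (c' : 'I_m.+1 -> int),
    [/\ c k != 0 /\ (forall i, c k %| c i)%Z,
        c' k != 0 /\ (forall i, c' k %| c' i)%Z &
        \sum_i coroot (r i) *~ c' i = 0].
Proof.
move=> RS rP circ; have ir := root_integral_family RS rP.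
have [p [q [N [pp q0 Np NP]]]] := circuit_two_lengths RS rP circ.
have N0 i : N i != 0%N by case: (Np i) => -> //; rewrite -lt0n prime_gt0.
have circ' := circuit_coroot ir q0 N0 NP circ.
have [k ck kP] := circuit_divisor ir circ.
have [l cl lP] := circuit_divisor (integral_coroot ir) circ'.
have [_ _ rel'] := circ'; pose c' i := c i * (N i)%:Z.
suff [[lP1 cl1]|kP1] :
    ((forall i, c l %| c i)%Z /\ c l != 0) \/ (c' k %| c' l)%Z.
- by exists l, c'.
- exists k, c'; split=> //; split=> [|i]; first by rewrite mulf_neq0 // N0.
  exact: dvdz_trans kP1 (lP i).
have cl0 : c l != 0 by apply: contraNneq cl => ->; rewrite mul0r.
have /dvdzP[z Ez] := kP l.
have dvd_zN : (z * (N l)%:Z %| (N k)%:Z)%Z.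
  by have := lP k; rewrite Ez [z * _]mulrC -mulrA dvdz_mul2l.
have {}dvd_zN : (`|z| * N l %| N k)%N by move: dvd_zN; rewrite dvdzE abszM.
have [z1|z1] := eqVneq `|z|%N 1%N.
  left; split=> // i; apply: dvdz_trans (kP i).
  by rewrite Ez dvdzE abszM z1 mul1n.
right; rewrite /c' Ez [z * _]mulrC -mulrA dvdz_mul2l // dvdzE abszM /=.
case: (Np k) => Nk; first by rewrite Nk dvd1n.
rewrite Nk in dvd_zN *; apply: dvdn_mulr.
have /primeP[_ /(_ _ (dvdn_trans (dvdn_mulr _ (dvdnn _)) dvd_zN))] := pp.
by rewrite (negPf z1) => /eqP ->.
Qed.

(** Divide the relation by c_k, which is possible in a real vector space. *)
Lemma zspan_divisible m (r : 'I_m -> V) (c : 'I_m -> int) (t : seq V) k :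
    \sum_i r i *~ c i = 0 -> c k != 0 -> (forall i, c k %| c i)%Z ->
    (forall i, i != k -> zspan t (r i)) ->
  zspan t (r k).
Proof.
move=> rel ck kP rt.
have /fin_all_exists[q qP] i : exists q, c i = q * c k by exact/dvdzP.
have : \sum_i r i *~ q i = 0.
  have ckR : ((c k)%:~R : R) != 0 by rewrite intr_eq0.
  apply: (scalerI ckR); rewrite scaler0 -[RHS]rel -scale_intr mulrz_suml.
  by apply: eq_bigr => i _; rewrite -mulrzA -qP.
have qk : q k = 1 by apply: (mulIf ck); rewrite -qP mul1r.
rewrite (bigD1 k) //= qk mulr1z => /eqP; rewrite addr_eq0 => /eqP ->.
by apply/zspanN/zspan_sum => i /rt; apply: zspanMz.
Qed.

Lemma zfreeP n (s : seq V) : size s = n ->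
  zfree s <-> int_free (fun i : 'I_n => s`_i).
Proof.
move=> <-; split=> fr y rel i; last exact: fr rel i.
have /fr/(_ i) : \sum_(j < size s) s`_j *~ [ffun j => y j] j = 0.
  by rewrite -[RHS]rel; apply: eq_bigr => j _; rewrite ffunE.
by rewrite ffunE.
Qed.

Lemma zfree_coroot Phi s : root_system ip Phi -> {subset s <= Phi} ->
  zfree s -> zfree (map coroot s).
Proof.
move=> RS sP /(zfreeP erefl)-fr; apply/(zfreeP (size_map _ _)).
have ir := root_integral_family RS
  (fun i : 'I_(size s) => sP _ (mem_nth 0 (ltn_ord i))).
move=> y rel; apply: (int_free_coroot ir fr); rewrite -[RHS]rel.
by apply: eq_bigr => i _; rewrite (nth_map 0).
Qed.

(** The shortest dependent tail of s is a root followed by a free list, that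
    is, it carries a circuit. *)
Lemma redundant_root Phi s : root_system ip Phi -> {subset s <= Phi} ->
    uniq s -> ~ zfree s ->
  exists2 b, b \in s & let s' := [seq x <- s | x != b] in
    zspan s' b /\ zspan (map coroot s') (coroot b).
Proof.
move=> RS; elim: s => [|a s IHs] sP; first by move=> _ []; move=> ? _ [].
rewrite cons_uniq => /andP[nas us] nfr.
have [frs|nfrs] := pselect (zfree s); last first.
  have [|b bs [bs1 bs2]] := IHs _ us nfrs.
    by move=> x xs; apply: sP; rewrite inE xs orbT.
  have sub : {subset [seq x <- s | x != b] <= [seq x <- a :: s | x != b]}.
    by apply: mem_subseq; rewrite /=; case: ifP => // _; apply: subseq_cons.
  exists b; first by rewrite inE bs orbT.
  split; first exact: zspan_sub bs1.
  by apply: zspan_sub bs2 => _ /mapP[x /sub xs ->]; apply: map_f.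
have [c [c0 rel]] := zfree_head frs nfr.
pose r (i : 'I_(size s).+1) := (a :: s)`_i.
have rP i : r i \in Phi by apply: sP; apply: mem_nth.
have circ : circuit r c.
  split=> //; have /(zfreeP erefl) fr := frs.
  by move=> y rel_y; apply: fr; rewrite -[RHS]rel_y; apply: eq_bigr.
have [k [c' [[ck kP] [c'k k'P] rel']]] := circuit_common_divisor RS rP circ.
have mem_r i : i != k -> r i \in [seq x <- a :: s | x != r k].
  move=> ik; rewrite mem_filter mem_nth ?andbT //.
  by rewrite nth_uniq //= nas us.
exists (r k); first exact: mem_nth.
split; first by apply: (zspan_divisible rel ck kP) => i /mem_r/zspan_mem.
apply: (zspan_divisible rel' c'k k'P) => i /mem_r ri.
exact/zspan_mem/map_f.
Qed.

End IntegralFamily.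

(** * Reflections generating a Coxeter group *)

Section CoxeterGroup.
Variables (gT : finGroupType) (W : {group gT}) (S : {set gT}).
Implicit Types (X Y : {set gT}).
Local Open Scope group_scope.

Lemma gen_ind X (P : gT -> Prop) : P 1 ->
    (forall x w, x \in X -> w \in <<X>> -> P w -> P (x * w)) ->
  forall w, w \in <<X>> -> P w.
Proof.
move=> P1 PM w /gen_prodgP[n [c cX ->]].
suff [] : \prod_(i < n) c i \in <<X>> /\ P (\prod_(i < n) c i) by [].
elim: n c cX => [|n IHn] c cX; first by rewrite big_ord0 group1.
have [wX Pw] := IHn (fun i => c (lift ord0 i)) (fun i => cX _).
rewrite big_ord_recl; split; last exact: PM.
by rewrite groupM // mem_gen.
Qed.

(** Conjugating t by a power u of d = s t gives u^2 t, whereas s = d t; a d of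
    odd order is the square of one of its powers. *)
Lemma conj_involutions (s t : gT) : #[s] = 2 -> #[t] = 2 -> odd #[s * t] ->
  s = (s * t) ^+ #[s * t]./2.+1 * t * (s * t) ^- #[s * t]./2.+1.
Proof.
move=> s2 t2 odd_st; set d := s * t; set k := _.+1.
have ss : s * s = 1 by rewrite -(expg_order s) s2 expgS expg1.
have tt : t * t = 1 by rewrite -(expg_order t) t2 expgS expg1.
have sV : s^-1 = s by apply/eqP; rewrite eq_invg_mul ss.
have tV : t^-1 = t by apply/eqP; rewrite eq_invg_mul tt.
have ts : t * d ^- k = d ^+ k * t.
  apply: (mulgI t^-1); rewrite mulKg.
  have -> : t^-1 * (d ^+ k * t) = (d ^+ k) ^ t by [].
  by rewrite conjXg -expgVn /conjg /d invMg sV tV -!mulgA tt mulg1.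
rewrite -mulgA ts mulgA -expgD -/d addnn /k doubleS.
have -> : (#[d]./2).*2.+2 = (#[d] + 1)%N.
  by rewrite -(odd_double_half #[d]) odd_st; lia.
by rewrite expgD expg_order mul1g expg1 /d -mulgA tt mulg1.
Qed.

Hypothesis WS : Coxeter_system W S.

Lemma Coxeter_sub : S \subset W.
Proof. by rewrite -(Coxeter_gen WS) subset_gen. Qed.

Lemma reflections_sub : reflections W S \subset W.
Proof.
apply/subsetP => _ /imset2P[w s wW sS ->].
by rewrite !groupM ?groupV // (subsetP Coxeter_sub).
Qed.

(** The sign character that is trivial exactly on those s in S which have a
    conjugate in X is well defined on the presentation, and X lies in its
    kernel. *)
Lemma generating_conjugates X s : X \subset reflections W S -> <<X>> = W ->
  s \in S -> exists w x, [/\ w \in W, x \in X & s = w * x * w^-1].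
Proof.
move=> XT genX; pose C := [set w * x * w^-1 | w in W, x in X].
suff SC : {in S, forall s, s \in C}.
  by move=> /SC/imset2P[w x wW xX ->]; exists w, x.
have CJ w s' : w \in W -> s' \in C -> w * s' * w^-1 \in C.
  move=> wW /imset2P[u x uW xX ->]; apply/imset2P; exists (w * u) x => //.
    exact: groupM.
  by rewrite invMg !mulgA.
pose tau : {perm bool} := tperm true false.
pose f s' : {perm bool} := if s' \in C then 1 else tau.
have tau2 : tau * tau = 1 by apply: tperm2.
have tau_neq1 : tau != 1.
  by apply/eqP => /permP/(_ true); rewrite tpermL perm1.
have [|g gM gf] := Coxeter_presentation WS (H := {perm bool}) (f := f).
  move=> s1 s2 s1S s2S /=; rewrite /f.
  have Cconj a b : a \in S -> b \in S -> odd #[a * b] -> b \in C -> a \in C.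
    move=> aS bS ab bC.
    have [a2 b2] := (Coxeter_involution WS aS, Coxeter_involution WS bS).
    rewrite (conj_involutions a2 b2 ab).
    by apply: CJ => //; rewrite groupX // groupM // (subsetP Coxeter_sub).
  have even_tau n : ~~ odd n -> tau ^+ n = 1.
    move=> /even_halfK <-; rewrite -muln2 mulnC expgM.
    by rewrite [tau ^+ 2]tau2 expg1n.
  case: ifPn => C1; case: ifPn => C2.
  - by rewrite mulg1 expg1n.
  - rewrite mul1g even_tau //; apply: contra C2 => odd12.
    apply: (Cconj _ s1) => //.
    suff -> : #[s2 * s1] = #[s1 * s2] by [].
    by rewrite -[RHS](orderJ _ s1) /conjg mulgA mulKg.
  - rewrite mulg1 even_tau //; apply: contra C1 => odd12.
    exact: (Cconj _ s2).
  - by rewrite tau2 expg1n.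
have g1 : g 1 = 1.
  by apply: (mulgI (g 1)); rewrite -gM ?group1 // !mulg1.
have gX x : x \in X -> g x = 1.
  move=> xX; have /imset2P[w s' wW s'S Ex] := subsetP XT x xX.
  have s'W := subsetP Coxeter_sub _ s'S.
  have s'C : s' \in C.
    apply/imset2P; exists w^-1 x; rewrite ?groupV //.
    by rewrite Ex invgK -!mulgA mulVg mulg1 mulKg.
  rewrite Ex !gM ?groupM ?groupV // (gf s') // /f s'C mulg1.
  by rewrite -gM ?groupV // mulgV g1.
have gW w : w \in W -> g w = 1.
  rewrite -genX; move: w; apply: gen_ind => // x w xX wX gw1.
  have xW : x \in W by rewrite -genX mem_gen.
  by rewrite genX in wX; rewrite gM // gX // gw1 mulg1.
move=> s' s'S; apply: contraT => s'C; case/negP: tau_neq1; apply/eqP.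
by rewrite -(gW s') ?gf // ?(subsetP Coxeter_sub) // /f (negPf s'C).
Qed.

End CoxeterGroup.

(** * Generation and the two lattices *)

Section Weyl.
Variables (R : realType) (V : vectType R) (ip : {dot V for (@idfun R)}).
Variables (gT : finGroupType) (W : {group gT}) (S : {set gT}).
Variables (rho : gT -> 'End(V)) (alpha : gT -> V).
Hypothesis WS : Coxeter_system W S.
Hypothesis geom : geometric_representation ip W S rho alpha.
Hypothesis Phi_reduced : reduced_roots (Coxeter_roots W S rho alpha).
Hypothesis Phi_cryst : crystallographic ip (Coxeter_roots W S rho alpha).

Local Notation Phi := (Coxeter_roots W S rho alpha).
Local Notation "''s_' a" := (root_reflection ip a) (at level 8, a at level 2).
Local Notation coroot := (coroot ip).

Lemma rho_mul u w v : u \in W -> w \in W -> rho (u * w)%g v = rho u (rho w v).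
Proof. by move=> uW wW; rewrite (geomM geom) // lfunE. Qed.

Lemma rhoV u v : u \in W -> rho u (rho u^-1%g v) = v.
Proof. by move=> uW; rewrite -rho_mul ?groupV // mulgV (geom1 geom) lfunE. Qed.

Lemma rho_isometry w u v : w \in W -> ip (rho w u) (rho w v) = ip u v.
Proof.
rewrite -(Coxeter_gen WS) => wW; move: w wW u v; apply: gen_ind => [|s w sS].
  by move=> u v; rewrite (geom1 geom) !lfunE.
rewrite (Coxeter_gen WS) => wW IHw u v.
have sW := subsetP (Coxeter_sub WS) _ sS.
by rewrite !rho_mul // !(geom_reflect geom sS) refl_ip IHw.
Qed.

Lemma rho_reflection w a v : w \in W -> rho w ('s_a v) = 's_(rho w a) (rho w v).
Proof. by move=> wW; apply: refl_isometry => x y; apply: rho_isometry. Qed.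

Lemma Coxeter_rootP b : reflect
  (exists w s, [/\ w \in W, s \in S & b = rho w (alpha s)]) (b \in Phi).
Proof.
apply: (iffP allpairsP) => [[[w s] /= [wW sS ->]]|[w [s [wW sS ->]]]].
  by exists w, s; rewrite !mem_enum in wW sS.
by exists (w, s); rewrite /= !mem_enum.
Qed.

Lemma rho_root w b : w \in W -> b \in Phi -> rho w b \in Phi.
Proof.
move=> wW /Coxeter_rootP[u [s [uW sS ->]]]; apply/Coxeter_rootP.
by exists (w * u)%g, s; rewrite groupM ?rho_mul.
Qed.

Lemma rho_conj w x a : w \in W -> x \in W -> (forall v, rho x v = 's_a v) ->
  forall v, rho (w * x * w^-1)%g v = 's_(rho w a) v.
Proof.
move=> wW xW xP v; rewrite !rho_mul ?groupM ?groupV // xP rho_reflection //.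
by rewrite rhoV.
Qed.

Lemma root_reflection_mem b : b \in Phi ->
  exists2 t, t \in W & forall v, rho t v = 's_b v.
Proof.
move=> /Coxeter_rootP[w [s [wW sS ->]]]; exists (w * s * w^-1)%g.
  by rewrite !groupM ?groupV // (subsetP (Coxeter_sub WS)).
apply: rho_conj => //; first exact: (subsetP (Coxeter_sub WS)).
exact: (geom_reflect geom).
Qed.

Lemma Coxeter_root_system : root_system ip Phi.
Proof.
split=> // [_ /Coxeter_rootP[w [s [wW sS ->]]]|a b aP bP].
  apply: contraNneq (geom_neq0 geom sS) => E; apply/eqP/(ip_eq0 (ip := ip)).
  by rewrite -(rho_isometry _ _ wW) E ip0l.
have [t tW <-] := root_reflection_mem aP; exact: rho_root.
Qed.
Let RS := Coxeter_root_system.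
Let RSv := coroot_system RS.

Lemma eq_root_reflection a b : a \in Phi -> b \in Phi -> 's_a =1 's_b ->
  a = b \/ a = - b.
Proof.
move=> aP bP /(refl_eq_colinear (root_neq0 RS aP) (root_neq0 RS bP))[k Ek].
have [|k1|k1] := Phi_reduced bP (c := k); first by rewrite -Ek.
  by left; rewrite Ek k1 scale1r.
by right; rewrite Ek k1 scaleN1r.
Qed.

Section ReflectionSet.
Variables (X : {set gT}) (r : gT -> V).
Hypothesis XT : X \subset reflections W S.
Hypothesis Xr : root_choice ip W S rho alpha X r.
Local Notation RX := (map r (enum X)).
Local Notation RXv := (map coroot RX).

Lemma XW x : x \in X -> x \in W.
Proof. by move/(subsetP XT)/(subsetP (reflections_sub WS)). Qed.

Lemma mem_RX x : x \in X -> r x \in RX.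
Proof. by move=> xX; apply: map_f; rewrite mem_enum. Qed.

Lemma RXP a : a \in RX -> exists2 x, x \in X & a = r x.
Proof. by case/mapP => x; rewrite mem_enum; exists x. Qed.

Lemma RX_sub : {subset RX <= Phi}.
Proof. by move=> _ /RXP[x xX ->]; have [] := Xr xX. Qed.

Lemma RX_uniq : uniq RX.
Proof.
rewrite map_inj_in_uniq ?enum_uniq // => x y; rewrite !mem_enum => xX yX E.
apply: (geom_faithful geom) (XW xX) (XW yX) _; apply/lfunP => v.
by rewrite (Xr xX).2 (Xr yX).2 E.
Qed.

Lemma rho_zspan w b : w \in <<X>>%g -> b \in Phi ->
  zspan RX b /\ zspan RXv (coroot b) ->
  zspan RX (rho w b) /\ zspan RXv (coroot (rho w b)).
Proof.
move=> wX bP; move: w wX; apply: gen_ind => [|x w xX wX IHw] bR.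
  by rewrite (geom1 geom) lfunE.
have XWg : <<X>>%g \subset W by rewrite gen_subG; apply/subsetP/XW.
have wW := subsetP XWg _ wX; have [rxP rxE] := Xr xX.
have wbP := rho_root wW bP; have [b1 b2] := IHw bR.
have [xW rxR] := (XW xX, mem_RX xX).
rewrite rho_mul // rxE; split.
  exact: (zspan_refl RS rxP wbP (zspan_mem rxR) b1).
have rx0 := root_neq0 RS rxP.
rewrite -(coroot_isometry (f := 's_(r x))) ?refl_ip //; last exact: reflZr.
rewrite -refl_coroot //; apply: (zspan_refl RSv _ _ _ b2); try exact: map_f.
exact/zspan_mem/map_f.
Qed.

(** A root w (alpha_s) is, up to sign, u (r x) with x in X and u in W = <X>,
    and the reflections in R preserve both spans. *)
Lemma generating_lattice : <<X>>%g = W ->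
  same_lattice RX Phi /\ same_lattice RXv (map coroot Phi).
Proof.
move=> genX.
have all_span b : b \in Phi -> zspan RX b /\ zspan RXv (coroot b).
  move=> /[dup] bP /Coxeter_rootP[v [s [vW sS Eb]]].
  have [w [x [wW xX Es]]] := generating_conjugates WS XT genX sS.
  have [rxP rxE] := Xr xX; have uW : (v * w)%g \in W by apply: groupM.
  have uX : (v * w)%g \in <<X>>%g by rewrite genX.
  have [|sp1 sp2] := rho_zspan uX rxP _.
    by split; apply: zspan_mem; [exact: mem_RX | exact/map_f/mem_RX].
  have sW := subsetP (Coxeter_sub WS) _ sS.
  have : 's_b =1 's_(rho (v * w)%g (r x)).
    move=> y; rewrite -(rho_conj uW (XW xX) rxE) Eb.
    rewrite -(rho_conj vW sW (geom_reflect geom sS)) Es.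
    by rewrite invMg !mulgA.
  case/(eq_root_reflection bP (rho_root uW rxP)) => -> //.
  by rewrite corootN; split; apply: zspanN.
split; apply: same_lattice_sub => [a aR|a].
- exact/zspan_mem/RX_sub.
- by case/all_span.
- have /mapP[b bR ->] := aR; exact/zspan_mem/map_f/RX_sub.
- by case/mapP => b /all_span[_ ?] ->.
Qed.

(** Let P b say that the reflection in b belongs to <X>.  It depends only on
    the line of b, so the descent may be run on b or on its coroot. *)
Lemma lattice_generating : same_lattice RX Phi ->
  same_lattice RXv (map coroot Phi) -> <<X>>%g = W.
Proof.
move=> lat latv; apply/eqP; rewrite eqEsubset gen_subG.
apply/andP; split; first by apply/subsetP/XW.
pose P b := exists2 w, w \in <<X>>%g & forall v, rho w v = 's_b v.
have XWg : {subset <<X>>%g <= W}.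
  by apply/subsetP; rewrite gen_subG; apply/subsetP/XW.
have PX x : x \in X -> P (r x).
  by move=> xX; exists x; [exact: mem_gen | exact: (Xr xX).2].
have Prefl x b : x \in X -> P ('s_(r x) b) -> P b.
  move=> xX [w wX wE]; exists (x * w * x^-1)%g.
    by have xG := mem_gen xX; rewrite !groupM ?groupV.
  by move=> v; rewrite (rho_conj (XW xX) (XWg _ wX) wE) (Xr xX).2 reflK.
have PN a : P a -> P (- a).
  by move=> [w wX wE]; exists w => // v; rewrite reflNl.
have Pcoroot a : a != 0 -> P (coroot a) <-> P a.
  by move=> a0; split=> -[w wX wE]; exists w => // v; rewrite wE refl_coroot.
have rx0 x : x \in X -> r x != 0 by move=> /Xr[/(root_neq0 RS)].
have allP b : b \in Phi -> P b.
  move=> bP; have [sb|sb] := short_or_long RS bP.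
    apply: (short_root_descent RS RX_sub _ _ _ bP sb) => //.
    - by move=> _ /RXP[x xX ->]; apply: PX.
    - by move=> _ c /RXP[x xX ->] _; apply: Prefl.
    - exact/lat/zspan_mem.
  apply/(Pcoroot _ (root_neq0 RS bP)).
  apply: (short_root_descent RSv (s := RXv) _ _ _ _ _ sb) => //.
  - by move=> _ /mapP[a /RX_sub aP ->]; apply: map_f.
  - by move=> _ /mapP[_ /RXP[x xX ->] ->]; apply/Pcoroot; [exact: rx0 | exact: PX].
  - move=> _ c /mapP[_ /RXP[x xX ->] ->] _ [w wX wE].
    apply: (Prefl x) => //; exists w => // v.
    by rewrite wE; congr root_reflection; rewrite refl_coroot ?rx0.
  - exact: map_f.
  - exact/latv/zspan_mem/map_f.
rewrite -{1}(Coxeter_gen WS) gen_subG; apply/subsetP => s sS.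
have sW := subsetP (Coxeter_sub WS) _ sS.
have [|w wX wE] := allP (alpha s).
  apply/Coxeter_rootP; exists 1%g, s; rewrite group1 (geom1 geom) lfunE.
  by split.
suff -> : s = w by [].
apply: (geom_faithful geom) sW (XWg _ wX) _; apply/lfunP => v.
by rewrite wE (geom_reflect geom).
Qed.

End ReflectionSet.

Lemma root_choice_sub (X Y : {set gT}) (r : gT -> V) : Y \subset X ->
  root_choice ip W S rho alpha X r -> root_choice ip W S rho alpha Y r.
Proof. by move=> YX Xr t /(subsetP YX)/Xr. Qed.

(** A root that is redundant for both lattices gives a reflection that can be
    dropped from X by [lattice_generating]; conversely a proper generating
    subset would span, by [generating_lattice], the root of a dropped
    reflection. *)
Lemma minimal_generating_free (X : {set gT}) (r : gT -> V) :
    X \subset reflections W S ->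
    root_choice ip W S rho alpha X r ->
    <<X>>%g = W -> minimal_generating W S X <-> zfree (map r (enum X)).
Proof.
move=> XT Xr genX; have [lat latv] := generating_lattice XT Xr genX.
split=> [/minsetP[_ minX]|fr].
  apply: contrapT => /(redundant_root RS (RX_sub Xr) (RX_uniq XT Xr))[b].
  case/RXP=> t tX ->; set s' := filter _ _ => -[sp1 sp2].
  have YX : X :\ t \subset X by apply: subD1set.
  have YT := subset_trans YX XT; have Yr := root_choice_sub YX Xr.
  have s'Y : {subset s' <= map r (enum (X :\ t))}.
    move=> a; rewrite mem_filter => /andP[at_ /RXP[x xX Ea]].
    rewrite Ea; apply: mem_RX; rewrite !inE xX andbT.
    by apply: contraNneq at_ => <-; rewrite Ea.
  have s'Yv : {subset map coroot s' <= map coroot (map r (enum (X :\ t)))}.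
    by move=> _ /mapP[a /s'Y aY ->]; apply: map_f.
  have RXsub a : a \in map r (enum X) -> a = r t \/ a \in s'.
    by move=> aX; rewrite mem_filter aX andbT; case: eqVneq; [left | right].
  suff genY : <<X :\ t>>%g = W.
    have := minX (X :\ t); rewrite YT genY eqxx => /(_ isT YX) E.
    by move: tX; rewrite -E !inE eqxx.
  apply: (lattice_generating YT Yr) => v.
    rewrite -(lat v); split; first apply: zspan_sub.
      by move=> _ /RXP[x xY ->]; apply/mem_RX/(subsetP YX).
    apply: zspan_trans => a /RXsub[->|/s'Y/zspan_mem //].
    exact: zspan_sub sp1.
  rewrite -(latv v); split; first apply: zspan_sub.
    by move=> _ /mapP[_ /RXP[x xY ->] ->]; apply/map_f/mem_RX/(subsetP YX).
  apply: zspan_trans => _ /mapP[a /RXsub[->|as'] ->].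
    exact: zspan_sub sp2.
  by apply/zspan_mem/s'Yv/map_f.
apply/minsetP; rewrite XT genX eqxx; split=> // Y /andP[YT /eqP genY] YX.
apply/eqP; rewrite eqEsubset YX; apply/subsetP => t tX; apply: contraT => tY.
have Yr := root_choice_sub YX Xr; have [rtP _] := Xr t tX.
have [latY _] := generating_lattice YT Yr genY.
have [] := zfree_irredundant fr (mem_RX r tX) (t := map r (enum Y)).
  move=> _ /RXP[x xY ->]; have xX := subsetP YX x xY; split; first exact: mem_RX.
  apply: contraNneq tY => E; suff <- : x = t by [].
  apply: (geom_faithful geom) (XW XT xX) (XW XT tX) _; apply/lfunP => v.
  by rewrite (Xr x xX).2 (Xr t tX).2 E.
exact/latY/zspan_mem.
Qed.

End Weyl.

Theorem corollary1p2 (R : realType) (V : vectType R)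
    (ip : ({dot V for (@idfun R)})%R)
    (gT : finGroupType) (W : {group gT}) (S : {set gT})
    (rho : gT -> 'End(V)) (alpha : gT -> V)
    (WS_Coxeter : Coxeter_system W S)
    (rho_geom : geometric_representation ip W S rho alpha)
    (Phi_reduced : reduced_roots (Coxeter_roots W S rho alpha))
    (Phi_cryst : crystallographic ip (Coxeter_roots W S rho alpha)) :
  let Phi := Coxeter_roots W S rho alpha in
  let Phiv := map (coroot ip) Phi in
  forall (X : {set gT}) (r : gT -> V),
    X \subset reflections W S ->
    root_choice ip W S rho alpha X r ->
    let RX := map r (enum X) in
    let RXv := map (coroot ip) RX in
    (<<X>>%g = W <-> same_lattice RX Phi /\ same_lattice RXv Phiv) /\
    (<<X>>%g = W ->
      (minimal_generating W S X <->
        lattice_basis Phi RX /\ lattice_basis Phiv RXv)).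
Proof.
move=> Phi Phiv X r XT Xr RX RXv.
have RS := Coxeter_root_system WS_Coxeter rho_geom Phi_reduced Phi_cryst.
have RXP := RX_sub Xr.
have lat := generating_lattice WS_Coxeter rho_geom Phi_reduced Phi_cryst XT Xr.
split.
  split; first exact: lat.
  by case; apply: (lattice_generating WS_Coxeter rho_geom).
move=> genX; have [latR latRv] := lat genX.
have minE := minimal_generating_free WS_Coxeter rho_geom Phi_reduced Phi_cryst
  XT Xr genX.
split=> [/minE fr|[[fr _] _]]; last exact/minE.
by split; split=> //; apply: (zfree_coroot RS RXP fr).
Qed.
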